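(* Let $\rho$ be a quasi-order on $[n]$, let $\mathcal{A}_\rho \subseteq M_n$ be the corresponding structural matrix algebra, and let $\mathcal{Q}$ be its set of central classes. Let $\bullet$ be one of the following three operations: the standard matrix multiplication $(X,Y)\mapsto XY$, the Jordan product $X \diamond Y = XY+YX$, or the normalized Jordan product $X\circ Y=\frac12(XY+YX)$. Consider arbitrary injective maps $\phi : \mathcal{A}_\rho \to M_n$ (not assumed linear or additive) which satisfy $$\phi(X \bullet Y) = \phi(X) \bullet \phi(Y), \quad \text{for all } X,Y \in \mathcal{A}_\rho. \qquad ( * )$$ The following conditions are equivalent: (i) $|C| \ge 2$ for all $C \in \mathcal{Q}$ (i.e. $\mathcal{A}_\rho$ does not contain a central rank-one idempotent). (ii) All injective maps $\phi : \mathcal{A}_\rho \to M_n$ satisfying $( * )$ are additive. (iii) For any injective map $\phi : \mathcal{A}_\rho \to M_n$ satisfying $( * )$ there exist an invertible matrix $T \in M_n^\times$, a transitive map $g : \rho \to \mathbb{C}^\times$, and for each $C \in \mathcal{Q}$ a nonzero ring endomorphism $\omega_C$ of $\mathbb{C}$ and an assignment $\dagger_C$ which is either the identity (always the case when $\phi$ is assumed to be multiplicative, i.e. when $\bullet$ is the standard matrix multiplication) or the transposition, such that $$\phi(X) = T\,g^*\left(\sum_{C \in \mathcal{Q}} \omega_C(P_C X)^{\dagger_C}\right) T^{-1}, \quad \text{for all } X \in \mathcal{A}_\rho,$$ where $(P_C)_{C\in\mathcal{Q}}$ is the basis of mutually orthogonal idempotents of the centre $Z(\mathcal{A}_\rho)$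 given by $P_C=\sum_{i\in C}E_{ii}$.
   Context: $M_n = M_n(\mathbb{C})$ is the algebra of $n\times n$ complex matrices, $M_n^\times$ is its group of invertible elements, $[n]=\{1,\ldots,n\}$, and $E_{ij}$ are the standard matrix units. A quasi-order on $[n]$ is a reflexive and transitive binary relation $\rho \subseteq [n]^2$. The structural matrix algebra (SMA) defined by $\rho$ is $\mathcal{A}_\rho = \operatorname{span}\{E_{ij} : (i,j)\in\rho\}$, a unital subalgebra of $M_n$; these are precisely the subalgebras of $M_n$ containing all diagonal matrices. Write $i \approx_0 j$ if $(i,j)\in\rho$ or $(j,i)\in\rho$, and let $\approx$ be the transitive closure of $\approx_0$, an equivalence relation on $[n]$. The quotient set $[n]/{\approx}$ is denoted by $\mathcal{Q}$; its elements are called the central classes of $\mathcal{A}_\rho$. A map $g:\rho\to\mathbb{C}^\times$ (with $\mathbb{C}^\times=\mathbb{C}\setminus\{0\}$) is transitive if $g(i,j)g(j,k)=g(i,k)$ for all $(i,j),(j,k)\in\rho$. It induces the algebra automorphism $g^*$ of $\mathcal{A}_\rho$ defined on the basis of matrix units by $g^*(E_{ij})=g(i,j)E_{ij}$ for all $(i,j)\in\rho$. For a ring endomorphism $\omega$ of $\mathbb{C}$ and $X=[X_{ij}]\in M_n$, $\omega(X)=[\omega(X_{ij})]$ denotes entrywise application. $X^{\dagger_C}$ is $X$ if $\dagger_C$ is the identity, and the transpose $X^t$ if $\dagger_C$ is the transposition. *)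

(* Defs.v *)
From mathcomp Require Import all_boot all_order all_algebra.
From mathcomp Require Import complex reals.

Set Implicit Arguments.
Unset Strict Implicit.
Unset Printing Implicit Defensive.

Import GRing.Theory.
Local Open Scope ring_scope.

Definition quasi_order (n : nat) (rho : rel 'I_n) : Prop :=
  reflexive rho /\ transitive rho.

Definition sma (F : fieldType) (n : nat) (rho : rel 'I_n) : {vspace 'M[F]_n} :=
  <<[seq delta_mx p.1 p.2 | p : 'I_n * 'I_n in [pred p | rho p.1 p.2]]>>%VS.

(* [connect] is the reflexive transitive closure; on a reflexive [rho] the
   relation [i ~0 j] is already reflexive, so this is its transitive closure. *)
Definition central_rel (n : nat) (rho : rel 'I_n) : rel 'I_n :=
  connect [rel i j | rho i j || rho j i].

Definition central_classes (n : nat) (rho : rel 'I_n) : {set {set 'I_n}} :=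
  equivalence_partition (central_rel rho) [set: 'I_n].

Definition central_idem (F : fieldType) (n : nat) (c : {set 'I_n}) : 'M[F]_n :=
  \sum_(i in c) delta_mx i i.

(* A map rho -> F^x is a total function of which only the values on [rho]
   matter. *)
Definition transitive_map (F : fieldType) (n : nat) (rho : rel 'I_n)
    (g : 'I_n -> 'I_n -> F) : Prop :=
  (forall i j, rho i j -> g i j != 0) /\
  (forall i j k, rho i j -> rho j k -> g i j * g j k = g i k).

(* The linear map E_ij |-> g(i,j) E_ij for (i,j) in rho.  It also has to be
   applied to transposes of elements of the algebra, that is, to E_ij with only
   (j,i) in rho; there g is extended by g(i,j) = g(j,i)^-1, the only value
   compatible with g(i,j) g(j,i) = g(i,i) = 1.  Pairs with neither (i,j) nor
   (j,i) in rho play no role. *)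
Definition gstar (F : fieldType) (n : nat) (rho : rel 'I_n)
    (g : 'I_n -> 'I_n -> F) (X : 'M[F]_n) : 'M[F]_n :=
  \matrix_(i, j) ((if rho i j then g i j else (g j i)^-1) * X i j).

Lemma gstar_linear (F : fieldType) (n : nat) (rho : rel 'I_n)
    (g : 'I_n -> 'I_n -> F) (a : F) (X Y : 'M[F]_n) :
  gstar rho g (a *: X + Y) = a *: gstar rho g X + gstar rho g Y.
Proof. by apply/matrixP => i j; rewrite !mxE mulrDr mulrCA. Qed.

Lemma gstar_delta (F : fieldType) (n : nat) (rho : rel 'I_n)
    (g : 'I_n -> 'I_n -> F) (i j : 'I_n) :
  rho i j -> gstar rho g (delta_mx i j) = g i j *: delta_mx i j.
Proof.
move=> rij; apply/matrixP => k l; rewrite !mxE.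
by have [/andP[/eqP-> /eqP->]|_] := boolP (_ && _); rewrite ?rij ?mulr0.
Qed.

Variant product := Standard | Jordan | NormalizedJordan.

Definition bullet (F : fieldType) (n : nat) (op : product) (X Y : 'M[F]_n) :
    'M[F]_n :=
  match op with
  | Standard => X *m Y
  | Jordan => X *m Y + Y *m X
  | NormalizedJordan => 2^-1 *: (X *m Y + Y *m X)
  end.

(* Maps from the algebra to 'M_n are total functions on 'M_n of which only the
   restriction to the algebra matters. *)
Definition injective_hom (F : fieldType) (n : nat) (rho : rel 'I_n)
    (op : product) (phi : 'M[F]_n -> 'M[F]_n) : Prop :=
  {in sma F rho &, injective phi} /\
  {in sma F rho &, {morph phi : X Y / bullet op X Y}}.

Definition dagger (F : fieldType) (n : nat) (transposed : bool) (X : 'M[F]_n) :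
    'M[F]_n :=
  if transposed then X^T else X.

(* {rmorphism F -> F} requires omega 1 = 1; over a field this holds exactly for
   the nonzero additive and multiplicative maps, as omega 1 is idempotent. *)
Definition standard_form (F : fieldType) (n : nat) (rho : rel 'I_n)
    (T : 'M[F]_n) (g : 'I_n -> 'I_n -> F)
    (omega : {set 'I_n} -> {rmorphism F -> F}) (dag : {set 'I_n} -> bool)
    (X : 'M[F]_n) : 'M[F]_n :=
  T *m
  gstar rho g (\sum_(c in central_classes rho)
                 dagger (dag c) (map_mx (omega c) (central_idem F c *m X)))
  *m invmx T.

(* Main.v *)
Require Import Defs.
From HB Require Import structures.
From mathcomp Require Import all_boot all_order all_algebra.
From mathcomp Require Import complex reals.
From mathcomp Require Import ring.

(* (iii) => (ii) => (i): the standard form is additive, while on a singleton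
   class the algebra splits off a copy of the field, on which t |-> 1/t is
   injective and multiplicative but not additive.

   (i) => (iii): the images of E_11, ..., E_nn, minus phi(0), are n nonzero
   mutually orthogonal idempotents, hence simultaneously similar to the E_ii,
   and phi(0) = 0.  After this conjugation, multiplying by E_ii and E_jj cuts
   phi into entrywise maps.  Along an edge i <> j of rho, a product with E_ij
   whose (i,j) entry is a sum of two parameters shows that the diagonal entry
   maps are additive and agree, and they determine the maps of the other
   entries up to a scalar.  For the Jordan products phi(E_ij) is a multiple of
   E_ij or of E_ji; edges with a common end make the same choice, so the choice
   is constant on each central class. *)

Set Implicit Arguments.
Unset Strict Implicit.
Unset Printing Implicit Defensive.

Import GRing.Theory.
Local Open Scope ring_scope.


(** * Entries of products with matrix units *)

Section MatrixEntries.
Variables (F : fieldType) (m n p : nat).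

Lemma delta_mulmxE (X : 'M[F]_(n, p)) (i : 'I_m) j a b :
  (delta_mx i j *m X) a b = (a == i)%:R * X j b.
Proof.
rewrite mxE (bigD1 j) //= !mxE eqxx andbT big1 ?addr0 // => k /negPf kj.
by rewrite mxE kj andbF mul0r.
Qed.

Lemma mulmx_deltaE (X : 'M[F]_(m, n)) i (j : 'I_p) a b :
  (X *m delta_mx i j) a b = X a i * (b == j)%:R.
Proof.
rewrite mxE (bigD1 i) //= !mxE eqxx /= big1 ?addr0 // => k /negPf ki.
by rewrite mxE ki mulr0.
Qed.

End MatrixEntries.

(** * Structural matrix algebras: support and closure under the products *)

Section StructuralAlgebra.
Variables (F : fieldType) (n : nat) (rho : rel 'I_n).
Hypothesis rho_qo : quasi_order rho.
Notation A := (sma F rho).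
Implicit Types (X Y : 'M[F]_n) (i j k : 'I_n).

Lemma delta_mx_sma i j : rho i j -> delta_mx i j \in A.
Proof. by move=> rij; apply/memv_span/imageP; exists (i, j). Qed.

(** Turns membership in a span into a condition on entries, the form in which it is used everywhere
    below. *)
Lemma smaP X : reflect (forall i j, ~~ rho i j -> X i j = 0) (X \in A).
Proof.
apply: (iffP idP) => [/coord_span -> i j nij | X0].
  rewrite summxE big1 // => k _; rewrite mxE.
  set s := (X in X`_k); have /imageP[[u v] /= ruv ->] : s`_k \in s.
    by rewrite mem_nth // size_image.
  rewrite mxE; case: eqP => [ei|]; case: eqP => [ej|] /=; rewrite ?mulr0 //.
  by move: ruv; rewrite inE /= -ei -ej (negPf nij).
rewrite [X]matrix_sum_delta; apply: memv_suml => i _; apply: memv_suml => j _.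
have [rij|/X0->] := boolP (rho i j); last by rewrite scale0r mem0v.
by apply/memvZ/delta_mx_sma.
Qed.

Lemma delta_mx_diag_sma i : delta_mx i i \in A.
Proof. by apply/delta_mx_sma; case: rho_qo => + _; apply. Qed.

Lemma mulmx_sma X Y : X \in A -> Y \in A -> X *m Y \in A.
Proof.
case: rho_qo => _ rtr /smaP hX /smaP hY; apply/smaP => i j nij.
rewrite mxE big1 // => k _; have [rik|/hX->] := boolP (rho i k); last first.
  by rewrite mul0r.
rewrite hY ?mulr0 //; apply: contra nij; exact: rtr.
Qed.

Lemma scalar_mx_sma (c : F) : c%:M \in A.
Proof.
apply/smaP => i j; rewrite mxE; case: eqP => // ->.
by case: rho_qo => ->.
Qed.

Lemma jordan_sma X Y : X \in A -> Y \in A -> X *m Y + Y *m X \in A.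
Proof. by move=> hX hY; rewrite memvD // mulmx_sma. Qed.

Lemma bullet_sma op X Y : X \in A -> Y \in A -> bullet op X Y \in A.
Proof.
move=> hX hY; case: op => /=; rewrite ?memvZ ?jordan_sma //.
exact: mulmx_sma.
Qed.

End StructuralAlgebra.

(** * Central classes *)

Section CentralClasses.
Variables (n : nat) (rho : rel 'I_n).
Implicit Types (i j : 'I_n) (c : {set 'I_n}).

Lemma central_rel_equivalence : equivalence_rel (central_rel rho).
Proof.
apply/equivalence_relP; split=> [i|i j cij]; first exact: connect0.
apply: same_connect cij; apply: sym_connect_sym => x y /=.
by rewrite orbC.
Qed.

Definition central_class i : {set 'I_n} := [set j | central_rel rho i j].

Lemma central_class_id i : i \in central_class i.
Proof. by rewrite inE; apply: connect0. Qed.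

Lemma central_classesP c :
  reflect (exists i, c = central_class i) (c \in central_classes rho).
Proof.
apply: (iffP imsetP) => [[i _ ->]|[i ->]]; exists i => //.
  by apply/setP=> j; rewrite !inE.
by apply/setP=> j; rewrite !inE.
Qed.

Lemma central_class_eq i j :
  (central_class i == central_class j) = central_rel rho i j.
Proof.
have /equivalence_relP[refl tr] := central_rel_equivalence.
apply/eqP/idP => [/setP/(_ j)|/tr cij].
  by rewrite !inE refl.
by apply/setP => k; rewrite !inE cij.
Qed.

Lemma mem_central_class c i :
  c \in central_classes rho -> (i \in c) = (c == central_class i).
Proof.
by case/central_classesP=> j ->; rewrite inE central_class_eq.
Qed.

Lemma central_class_rho i j : rho i j -> central_class i = central_class j.
Proof.
move=> rij; apply/eqP; rewrite central_class_eq; apply: connect1.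
by rewrite /= rij.
Qed.

(* Otherwise [i] alone would be closed under [central_rel]. *)
Lemma central_class_neighbour i :
  (2 <= #|central_class i|)%N ->
  exists2 j, i != j & rho i j || rho j i.
Proof.
move=> c2; apply/exists_inP; apply: contraTT c2 => /exists_inPn no.
rewrite -ltnNge ltnS -(cards1 i) subset_leq_card //.
apply/subsetP => j; rewrite !inE => cij.
have cl : closed [rel i j | rho i j || rho j i] (pred1 i).
  apply: intro_closed => [|x y /= + /eqP xi].
    by apply: sym_connect_sym => x y /=; rewrite orbC.
  by rewrite xi inE eq_sym; apply: contraLR => /no.
by have := closed_connect cl cij; rewrite !inE eqxx => <-.
Qed.

End CentralClasses.

(** * Simultaneous diagonalization of orthogonal idempotents *)

Section OrthogonalIdempotents.
Variables (F : fieldType) (n : nat).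
Implicit Types (P Q : 'I_n -> 'M[F]_n) (Z : 'M[F]_n).

(** One non-zero row of each [Q i] gives a matrix [U] with [U *m Q j = delta_mx j j *m U].
    Multiplying a linear relation among the rows of [U] by [Q j] isolates its j-th coefficient, so
    [U] is invertible; [T] is its inverse. *)
Lemma orthogonal_idempotents_diag Q :
  (forall i, Q i != 0) ->
  (forall i j, Q i *m Q j = if i == j then Q i else 0) ->
  exists2 T, T \in unitmx & forall i, Q i = T *m delta_mx i i *m invmx T.
Proof.
move=> Q0 QQ.
have /fin_all_exists[r hr] i : exists k, row k (Q i) != 0.
  by have /rowV0Pn[v /submxP[u ->] uQ] : Q i != 0 by []; apply/existsP;
     apply: contraNT (Q0 i) => /existsPn h; apply/eqP/row_matrixP => k;
     apply/eqP; rewrite row0; apply/negPn/h.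
pose U := \matrix_i row (r i) (Q i).
have UQ j : U *m Q j = delta_mx j j *m U.
  apply/row_matrixP => i; rewrite row_mul rowK -row_mul QQ row_mul.
  have [->|ij] := eqVneq i j.
    by rewrite [row j (delta_mx _ _)]rowE mul_delta_mx -rowE rowK.
  by rewrite row0 rowE mul_delta_mx_0 ?mul0mx.
have Uu : U \in unitmx.
  rewrite -row_free_unit; apply: inj_row_free => v vU.
  apply/rowP => j; rewrite mxE.
  have : v *m U *m Q j = 0 by rewrite vU mul0mx.
  rewrite -mulmxA UQ mulmxA => /rowP h.
  have e : v *m delta_mx j j *m U = v 0 j *: row j U.
    rewrite rowE scalemxAl; congr (_ *m _).
    by apply/rowP => k; rewrite mulmx_deltaE !mxE eqxx.
  have : v 0 j *: row j U = 0 by apply/rowP => k; rewrite -e h mxE.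
  by move/eqP; rewrite rowK scaler_eq0 (negPf (hr j)) orbF => /eqP.
exists (invmx U); first by rewrite unitmx_inv.
by move=> i; rewrite invmxK -mulmxA -UQ mulKmx.
Qed.

(** Here [Z] stands for the image of 0. The differences [P i - Z] are n non-zero orthogonal
    idempotents, so they sum to the identity; since [Z] annihilates each of them, [Z = 0]. *)
Lemma idempotents_over_diag P Z :
  Z *m Z = Z -> (forall i, P i *m P i = P i) ->
  (forall i, P i *m Z = Z) -> (forall i, Z *m P i = Z) ->
  (forall i j, i != j -> P i *m P j = Z) -> (forall i, P i != Z) ->
  Z = 0 /\
  exists2 T, T \in unitmx & forall i, P i = T *m delta_mx i i *m invmx T.
Proof.
move=> ZZ PP PZ ZP PPn PnZ.
have [||T Tu hT] := @orthogonal_idempotents_diag (fun i => P i - Z).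
- by move=> i; rewrite subr_eq0.
- move=> i j; rewrite mulmxBl !mulmxBr ZZ ZP PZ subrr subr0.
  by have [->|ij] := eqVneq i j; rewrite ?PP // PPn // subrr.
have Z0 : Z = 0.
  have ZT i : Z *m (T *m delta_mx i i *m invmx T) = 0.
    by rewrite -hT mulmxBr ZP ZZ subrr.
  have <- : Z *m (T *m 1%:M *m invmx T) = Z by rewrite mulmx1 mulmxV ?mulmx1.
  have -> : 1%:M = \sum_(i < n) delta_mx i i :> 'M[F]_n.
    rewrite [1%:M]matrix_sum_delta; apply: eq_bigr => i _.
    rewrite (bigD1 i) //= mxE eqxx scale1r big1 ?addr0 // => j /negPf ji.
    by rewrite mxE eq_sym ji scale0r.
  by rewrite mulmx_sumr mulmx_suml mulmx_sumr big1.
by split=> //; exists T => // i; rewrite -hT Z0 subr0.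
Qed.

(* X(XY + YX) = 0 = (XY + YX)X makes X commute with Y. *)
Lemma idempotent_jordan0 (X Y : 'M[F]_n) : (2 : F) != 0 ->
  X *m X = X -> X *m Y + Y *m X = 0 -> X *m Y = 0 /\ Y *m X = 0.
Proof.
move=> F2 XX h.
have h1 : X *m Y + X *m Y *m X = 0.
  by have := congr1 (mulmx X) h; rewrite mulmxDr mulmx0 !mulmxA XX.
have h2 : X *m Y *m X + Y *m X = 0.
  by have := congr1 (mulmx^~ X) h; rewrite /= mulmxDl mul0mx -(mulmxA Y) XX.
have e : X *m Y = Y *m X by apply: (addIr (X *m Y *m X)); rewrite h1 addrC.
rewrite -e; move: h; rewrite -e -mulr2n -scaler_nat => /eqP.
by rewrite scaler_eq0 (negPf F2) => /eqP.
Qed.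

End OrthogonalIdempotents.


(** * Entries of Jordan homomorphisms fixing the diagonal matrix units *)

Section JordanEntries.
Variables (F : fieldType) (n : nat) (rho : rel 'I_n).
Hypotheses (F2 : (2 : F) != 0) (rho_qo : quasi_order rho).
Notation A := (sma F rho).
Notation E := (@delta_mx F n n).
Notation jordan := (@bullet F n Jordan).
Implicit Types (X Y : 'M[F]_n) (i j k a b : 'I_n) (psi : 'M[F]_n -> 'M[F]_n).

Lemma jordan_deltaE X i j a b :
  jordan X (E i j) a b = X a i * (b == j)%:R + (a == i)%:R * X j b.
Proof. by rewrite /= mxE mulmx_deltaE delta_mulmxE. Qed.

Lemma jordan_delta_diagE X k a b :
  jordan X (E k k) a b = ((a == k)%:R + (b == k)%:R) * X a b.
Proof.
rewrite jordan_deltaE; case: eqP => [->|_]; case: eqP => [->|_] /=; ring.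
Qed.

(** What is known of the map after conjugation. Both Jordan products are brought to this situation,
    where no factors 1/2 appear. *)
Definition jordan_fixing_diag psi :=
  [/\ injective_hom rho Jordan psi, psi 0 = 0 & forall i, psi (E i i) = E i i].

(** Transposition preserves the Jordan product, so the transposed case will follow from the other
    one. *)
Lemma jordan_fixing_diag_tr psi :
  jordan_fixing_diag psi -> jordan_fixing_diag (fun X => (psi X)^T).
Proof.
case=> [[inj mor] p0 pE]; split=> [|| i]; last by rewrite pE trmx_delta.
  split=> [X Y hX hY /trmx_inj|X Y hX hY]; first exact: inj.
  by rewrite mor //= linearD /= !trmx_mul addrC.
by rewrite p0 trmx0.
Qed.

(** The form in which condition (i) enters: see [central_class_neighbour]. *)
Definition has_neighbour i := exists2 j, i != j & rho i j || rho j i.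

Section FixPsi.
Variable psi : 'M[F]_n -> 'M[F]_n.
Hypothesis hpsi : jordan_fixing_diag psi.

Let psiM : {in A &, {morph psi : X Y / jordan X Y}}.
Proof. by case: hpsi => [[]]. Qed.

Let psi0 : psi 0 = 0. Proof. by case: hpsi. Qed.

Let psiE i : psi (E i i) = E i i. Proof. by case: hpsi. Qed.

Let EA i j : rho i j -> E i j \in A. Proof. exact: delta_mx_sma. Qed.

Let EEA i : E i i \in A. Proof. exact: delta_mx_diag_sma. Qed.

Let psi_neq0 X : X \in A -> X != 0 -> psi X != 0.
Proof.
case: hpsi => [[inj _] _ _] hX; apply: contraNneq => e.
by apply/eqP/inj; rewrite ?mem0v // psi0.
Qed.

Lemma psi_jordan_delta_diag X k a b : X \in A ->
  psi (jordan X (E k k)) a b = ((a == k)%:R + (b == k)%:R) * psi X a b.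
Proof. by move=> hX; rewrite psiM // psiE jordan_delta_diagE. Qed.

(* Multiplying by E_ii and by E_jj isolates the entries (i,j) and (j,i). *)
Lemma psi_offdiag_local X Y i j : X \in A -> Y \in A -> i != j ->
  X i j = Y i j -> X j i = Y j i -> psi X i j = psi Y i j.
Proof.
move=> hX hY ij e1 e2; have ji : j != i by rewrite eq_sym.
have cut Z : Z \in A ->
    psi Z i j = psi (jordan (jordan Z (E i i)) (E j j)) i j.
  move=> hZ; rewrite psi_jordan_delta_diag ?bullet_sma //.
  rewrite psi_jordan_delta_diag // !eqxx (negPf ij) (negPf ji) /=; ring.
rewrite (cut X) // (cut Y) //; congr (psi _ _ _).
apply/matrixP => a b; rewrite !jordan_delta_diagE.
have [->|ai] := eqVneq a i; have [->|bi] := eqVneq b i;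
  rewrite ?(negPf ij) ?(negPf ji);
  [|have [->|bj] := eqVneq b j|have [->|aj] := eqVneq a j|];
  rewrite ?e1 ?e2 ?eqxx /=; ring.
Qed.

Lemma psi_offdiag0 X i j : X \in A -> i != j ->
  X i j = 0 -> X j i = 0 -> psi X i j = 0.
Proof.
move=> hX ij e1 e2.
by rewrite (psi_offdiag_local hX (mem0v _) ij) ?psi0 ?e1 ?e2 mxE.
Qed.

(** Other off-diagonal entries vanish by locality. As the Jordan product of [E i j] with [E i i] is
    [E i j] again, each diagonal entry of the image equals twice itself or 0, hence is 0. *)
Lemma psi_delta i j : rho i j -> i != j ->
  psi (E i j) = psi (E i j) i j *: E i j + psi (E i j) j i *: E j i.
Proof.
move=> rij ij; have ji : j != i by rewrite eq_sym.
apply/matrixP => a b; rewrite !mxE.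
have [<-|ab] := eqVneq a b.
  have -> : psi (E i j) a a = 0.
    have : psi (jordan (E i j) (E i i)) a a = psi (E i j) a a.
      congr (psi _ _ _); apply/matrixP => k l.
      rewrite jordan_delta_diagE mxE.
      have [_|_] := eqVneq k i; have [->|_] := eqVneq l j => /=;
        rewrite ?(negPf ji) /=; ring.
    rewrite psi_jordan_delta_diag ?EA //; case: eqP => _ /=; last first.
      by rewrite addr0 mul0r.
    move/eqP; rewrite -subr_eq0 -{2}[psi _ _ _]mul1r -mulrBl addrK mul1r.
    by move/eqP.
  have -> : (a == i) && (a == j) = false.
    by case: eqP => // ->; rewrite (negPf ij).
  have -> : (a == j) && (a == i) = false.
    by case: eqP => // ->; rewrite (negPf ji).
  by rewrite !mulr0 addr0.
have [/andP[/eqP-> /eqP->]|n1] := boolP ((a == i) && (b == j)).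
  by rewrite (negPf ij) mulr1 mulr0 addr0.
have [/andP[/eqP-> /eqP->]|n2] := boolP ((a == j) && (b == i)).
  by rewrite mulr1 mulr0 add0r.
rewrite psi_offdiag0 ?EA // ?mxE ?(negPf n1) 1?andbC ?(negPf n2) //.
  by rewrite !mulr0 addr0.
Qed.

(** The main computing tool: by [psi_delta], a product with [E i j] is sent to a combination of
    products with [E i j] and [E j i]. *)
Lemma psi_jordan_delta X i j a b : X \in A -> rho i j -> i != j ->
  psi (jordan X (E i j)) a b =
    psi (E i j) i j * (psi X a i * (b == j)%:R + (a == i)%:R * psi X j b) +
    psi (E i j) j i * (psi X a j * (b == i)%:R + (a == j)%:R * psi X i b).
Proof.
move=> hX rij ij; rewrite psiM ?EA // {1}psi_delta //.
set x := psi _ i j; set y := psi _ j i; rewrite -!jordan_deltaE /=.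
rewrite mulmxDr mulmxDl -!scalemxAl -!scalemxAr addrACA -!scalerDr.
by rewrite mxE [X in X + _]mxE [X in _ + X]mxE.
Qed.

(** The Jordan square of [E i j] is 0, and the (i,i) entry of its image is twice the product of the
    two coefficients. Injectivity forbids both from vanishing. *)
Lemma psi_delta_orientation i j : rho i j -> i != j ->
  psi (E i j) i j * psi (E i j) j i = 0 /\
  (psi (E i j) j i == 0 -> psi (E i j) i j != 0).
Proof.
move=> rij ij; have ji : j != i by rewrite eq_sym.
split.
  have : psi (jordan (E i j) (E i j)) i i = 0.
    have -> : jordan (E i j) (E i j) = 0.
      by rewrite /= mul_delta_mx_0 // addr0.
    by rewrite psi0 mxE.
  rewrite psi_jordan_delta ?EA // !eqxx (negPf ij) /= => h.
  by apply: (mulfI F2); rewrite mulr0 -h; ring.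
move/eqP=> y0; apply/eqP => x0.
have /negP : psi (E i j) != 0.
  apply: psi_neq0; first exact: EA.
  apply/eqP => /matrixP/(_ i j); rewrite !mxE !eqxx => /eqP.
  by rewrite oner_eq0.
by apply; rewrite psi_delta // x0 y0 !scale0r addr0.
Qed.

(* Multiplying by E_ij turns the diagonal entries of [X] into their sum, placed
   off the diagonal, where [psi] is already under control. *)
Lemma psi_diag_sum i j : rho i j -> i != j ->
  exists f : F -> F, forall X, X \in A ->
    psi X i i + psi X j j = f (X i i + X j j).
Proof.
move=> rij ij; have ji : j != i by rewrite eq_sym.
set x := psi (E i j) i j; set y := psi (E i j) j i.
(* For t = X_ii + X_jj, [t *: E i j] agrees with the product of [X] and [E i j] at (i,j) and (j,i),
   so locality lets it replace that product. The image is read at the position whose coefficient is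
   non-zero. *)
exists (fun t => if y == 0 then psi (t *: E i j) i j / x
                 else psi (t *: E i j) j i / y) => X hX.
have [_ x0] := psi_delta_orientation rij ij; rewrite -/x -/y in x0.
have tA t : t *: E i j \in A by rewrite memvZ ?EA.
have JA : jordan X (E i j) \in A by rewrite bullet_sma ?EA.
have e1 : jordan X (E i j) i j = X i i + X j j.
  by rewrite jordan_deltaE !eqxx mulr1 mul1r.
have e2 : jordan X (E i j) j i = 0.
  by rewrite jordan_deltaE (negPf ij) (negPf ji) mulr0 mul0r addr0.
have e3 t : (t *: E i j) i j = t by rewrite !mxE !eqxx mulr1.
have e4 t : (t *: E i j) j i = 0 by rewrite !mxE (negPf ij) andbF mulr0.
have [y0|y0] := eqVneq y 0.
  apply: (canRL (mulfK (x0 _))); first exact/eqP.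
  rewrite (psi_offdiag_local (tA _) JA ij) ?e3 ?e4 //.
  rewrite psi_jordan_delta // -/x -/y y0 !eqxx /=; ring.
apply: (canRL (mulfK y0)).
rewrite (psi_offdiag_local (tA _) JA ji) ?e3 ?e4 //.
rewrite psi_jordan_delta // -/x -/y !eqxx (negPf ij) (negPf ji) /=; ring.
Qed.

(** * Diagonal entries: the future ring endomorphisms *)

Definition diag_action i t := psi (t *: E i i) i i.

Let tEA t i : t *: E i i \in A. Proof. by rewrite memvZ. Qed.

Lemma psi_diag_scale t i j : i != j -> psi (t *: E i i) j j = 0.
Proof.
move=> ij; have ji : j != i by rewrite eq_sym.
apply: (mulfI F2); rewrite mulr0.
transitivity (psi (jordan (t *: E i i) (E j j)) j j).
  by rewrite psi_jordan_delta_diag // eqxx /=; ring.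
rewrite (_ : jordan _ _ = 0) ?psi0 ?mxE // /=.
by rewrite -scalemxAl -scalemxAr !mul_delta_mx_0 // !scaler0 addr0.
Qed.

(** Evaluating [psi_diag_sum] at multiples of [E i i] and of [E j j] identifies both actions with
    the same [f]. Additivity then comes from [s *: E i i + t *: E j j], once the two summands are
    separated. *)
Lemma psi_edge_diag i j : rho i j -> i != j ->
  [/\ diag_action i =1 diag_action j,
      {morph diag_action i : s t / s + t},
      forall X, X \in A -> psi X i i = diag_action i (X i i) &
      forall X, X \in A -> psi X j j = diag_action i (X j j)].
Proof.
move=> rij ij; have ji : j != i by rewrite eq_sym.
have [f hf] := psi_diag_sum rij ij.
have fi t : diag_action i t = f t.
  have := hf _ (tEA t i); rewrite (psi_diag_scale _ ij) !mxE !eqxx (negPf ji) /=.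
  by rewrite mulr1 mulr0 !addr0.
have fj t : diag_action j t = f t.
  have := hf _ (tEA t j); rewrite (psi_diag_scale _ ji) !mxE !eqxx (negPf ij) /=.
  by rewrite mulr1 mulr0 !add0r.
(* The product with [E k k] doubles the entry (k,k) and kills (l,l). Thus [X] and its truncation to
   (k,k) give the same doubled value. *)
have half k l : k != l -> (forall X, X \in A ->
      psi X k k + psi X l l = f (X k k + X l l)) ->
    diag_action k =1 f -> forall X, X \in A -> psi X k k = f (X k k).
  move=> kl hk fk.
  have dbl X : X \in A -> 2 * psi X k k = f (2 * X k k).
    move=> hX; have := hk _ (bullet_sma rho_qo Jordan hX (EEA k)).
    rewrite !psi_jordan_delta_diag // !jordan_delta_diagE !eqxx.
    by rewrite eq_sym (negPf kl) !addr0 !mul0r !addr0.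
  move=> X hX; apply: (mulfI F2); rewrite dbl // -(fk (X k k)) dbl ?tEA //.
  by rewrite !mxE !eqxx mulr1.
have hi := half i j ij hf fi.
have hj : forall X, X \in A -> psi X j j = f (X j j).
  by apply: (half j i ji) => // X hX; rewrite addrC hf // addrC.
have fD s t : f (s + t) = f s + f t.
  have hA : s *: E i i + t *: E j j \in A by rewrite memvD.
  have := hf _ hA; rewrite hi // hj // !mxE !eqxx (negPf ij) (negPf ji) /=.
  by rewrite !mulr1 !mulr0 !addr0 !add0r.
split=> [t|s t|X hX|X hX]; rewrite ?fi ?fj ?fD //; [exact: hi | exact: hj].
Qed.

Lemma diag_action_rho i j : rho i j -> diag_action i =1 diag_action j.
Proof.
have [-> //|ij rij] := eqVneq i j; by have [] := psi_edge_diag rij ij.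
Qed.

Lemma psi_diagE X i : has_neighbour i -> X \in A ->
  psi X i i = diag_action i (X i i).
Proof.
case=> j ij /orP[rij|rji] hX.
  by have [_ _ + _] := psi_edge_diag rij ij; apply.
by rewrite eq_sym in ij; have [e _ _ ->] // := psi_edge_diag rji ij.
Qed.

Lemma diag_actionD i : has_neighbour i -> {morph diag_action i : s t / s + t}.
Proof.
case=> j ij /orP[rij|rji]; first by have [] := psi_edge_diag rij ij.
rewrite eq_sym in ij; have [e hD _ _] := psi_edge_diag rji ij => s t.
by rewrite -!e hD.
Qed.

Lemma diag_action1 i : diag_action i 1 = 1.
Proof. by rewrite /diag_action scale1r psiE mxE !eqxx. Qed.

(** The Jordan product of [s *: E i i] and [t *: E i i] is [2 * (s * t)] times [E i i]; additivity
    allows the 2 to be cancelled. *)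
Lemma diag_actionM i : has_neighbour i -> {morph diag_action i : s t / s * t}.
Proof.
move=> hi s t; apply: (mulfI F2).
transitivity (diag_action i (2 * (s * t))).
  by rewrite -[2]/(1 + 1) !mulrDl !mul1r diag_actionD.
have e : jordan (s *: E i i) (t *: E i i) i i = 2 * (s * t).
  by rewrite /= -!scalemxAl -!scalemxAr mul_delta_mx !mxE !eqxx /=; ring.
rewrite -e -psi_diagE ?bullet_sma // psiM // mxE.
have mulE u v : (psi (u *: E i i) *m psi (v *: E i i)) i i =
    diag_action i u * diag_action i v.
  rewrite mxE (bigD1 i) //= big1 ?addr0 // => k ki.
  rewrite psi_offdiag0 ?mul0r // ?mxE ?(negPf ki) ?andbF ?mulr0 //.
  by rewrite eq_sym.
by rewrite !mulE; ring.
Qed.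


Lemma diag_action0 i : diag_action i 0 = 0.
Proof. by rewrite /diag_action scale0r psi0 mxE. Qed.

(* Compares the (i,i) entries of the Jordan product with E_ij. *)
Lemma psi_swap X i j : rho i j -> i != j -> X \in A ->
  diag_action i (X j i) =
    psi (E i j) i j * psi X j i + psi (E i j) j i * psi X i j.
Proof.
move=> rij ij hX; have ji : j != i by rewrite eq_sym.
have hi : has_neighbour i by exists j; rewrite ?rij.
have e : jordan X (E i j) i i = X j i.
  by rewrite jordan_deltaE eqxx (negPf ij) mulr0 mul1r add0r.
rewrite -e -psi_diagE // ?bullet_sma ?EA // psi_jordan_delta //.
by rewrite !eqxx (negPf ij) /=; ring.
Qed.

(** For i <> k the Jordan product of [E i j] and [E j k] is [E i k]; its image is read at (i,k) and
    (k,i). *)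
Lemma psi_delta_comp i j k : rho i j -> rho j k -> i != j -> j != k -> i != k ->
  psi (E i k) i k = psi (E i j) i j * psi (E j k) j k /\
  psi (E i k) k i = psi (E i j) j i * psi (E j k) k j.
Proof.
move=> rij rjk ij jk ik.
have e : jordan (E i j) (E j k) = E i k.
  by rewrite /= mul_delta_mx mul_delta_mx_0 ?addr0 // eq_sym.
have kj : k != j by rewrite eq_sym.
rewrite -e !psi_jordan_delta ?EA // !eqxx.
rewrite (negPf ij) (negPf kj) (negPf ik) /=; split; ring.
Qed.

(** * Orientation of edges: identity or transposition *)

Definition flipped i j := psi (E i j) j i != 0.

(** Exactly one of the two coefficients of the image of [E i j] is non-zero, by
    [psi_delta_orientation]. *)
Lemma flippedN i j : rho i j -> i != j -> flipped i j = (psi (E i j) i j == 0).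
Proof.
move=> rij ij; have [/eqP + x0] := psi_delta_orientation rij ij.
rewrite /flipped mulf_eq0; have [y0|//] := eqVneq (psi (E i j) j i) 0.
  by rewrite (negPf (x0 _)) // y0.
by rewrite orbF.
Qed.

Lemma psi_delta_swap i j : rho i j -> rho j i -> i != j ->
  psi (E i j) i j * psi (E j i) j i + psi (E i j) j i * psi (E j i) i j = 1.
Proof.
move=> rij rji ij; rewrite -psi_swap ?EA //.
by rewrite mxE !eqxx diag_action1.
Qed.

(** With different orientations both terms of the sum in [psi_delta_swap] would vanish. *)
Lemma flipped_sym i j : rho i j -> rho j i -> i != j ->
  flipped i j = flipped j i.
Proof.
move=> rij rji ij; have ji : j != i by rewrite eq_sym.
have := psi_delta_swap rij rji ij.
have := flippedN rij ij; have := flippedN rji ji; rewrite /flipped.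
do 4!case: eqP => [->|_] //=; rewrite ?mulr0 ?mul0r ?addr0 => _ _ /eqP;
  by rewrite eq_sym oner_eq0.
Qed.

(** With different orientations both coefficients of the image of [E i k] would vanish. *)
Lemma flipped_comp i j k : rho i j -> rho j k -> i != j -> j != k -> i != k ->
  flipped i j = flipped j k.
Proof.
move=> rij rjk ij jk ik; have [_ rtr] := rho_qo; have rik := rtr _ _ _ rij rjk.
have [e1 e2] := psi_delta_comp rij rjk ij jk ik.
have := flippedN rij ij; have := flippedN rjk jk; have := flippedN rik ik.
rewrite /flipped e1 e2 !mulf_eq0.
by do 4!case: eqP => _ //=.
Qed.

(** The Jordan product of [E i j] and [E i k] is 0, whereas that of [E j i] and [E i k] is [E j k]:
    flipping only one edge would make a zero product non-zero. *)
Lemma flipped_source i j k : rho i j -> rho i k -> i != j -> i != k -> j != k ->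
  flipped i j = flipped i k.
Proof.
move=> rij rik ij ik jk.
have [ji kj ki] : [/\ j != i, k != j & k != i] by split; rewrite eq_sym.
have e : jordan (E i j) (E i k) = 0 by rewrite /= !mul_delta_mx_0 ?addr0.
have h a b : psi (jordan (E i j) (E i k)) a b = 0 by rewrite e psi0 mxE.
have /eqP : psi (E i j) j i * psi (E i k) i k = 0.
  rewrite -(h j k) psi_jordan_delta ?EA // !eqxx.
  rewrite ?(negPf ji, negPf ij, negPf jk, negPf kj, negPf ki, negPf ik) /=.
  ring.
have /eqP : psi (E i j) i j * psi (E i k) k i = 0.
  rewrite -(h k j) psi_jordan_delta ?EA // !eqxx.
  rewrite ?(negPf ji, negPf ij, negPf jk, negPf kj, negPf ki, negPf ik) /=.
  ring.
have := flippedN rij ij; have := flippedN rik ik.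
by rewrite /flipped !mulf_eq0; do 4!case: eqP => _ //=.
Qed.

Lemma flipped_target i j k : rho j i -> rho k i -> j != i -> k != i -> j != k ->
  flipped j i = flipped k i.
Proof.
move=> rji rki ji ki jk.
have [ij kj ik] : [/\ i != j, k != j & i != k] by split; rewrite eq_sym.
have e : jordan (E j i) (E k i) = 0 by rewrite /= !mul_delta_mx_0 ?addr0.
have h a b : psi (jordan (E j i) (E k i)) a b = 0 by rewrite e psi0 mxE.
have /eqP : psi (E j i) j i * psi (E k i) i k = 0.
  rewrite -(h j k) psi_jordan_delta ?EA // !eqxx.
  rewrite ?(negPf ji, negPf ij, negPf jk, negPf kj, negPf ki, negPf ik) /=.
  ring.
have /eqP : psi (E j i) i j * psi (E k i) k i = 0.
  rewrite -(h k j) psi_jordan_delta ?EA // !eqxx.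
  rewrite ?(negPf ji, negPf ij, negPf jk, negPf kj, negPf ki, negPf ik) /=.
  ring.
have := flippedN rji ji; have := flippedN rki ki.
by rewrite /flipped !mulf_eq0; do 4!case: eqP => _ //=.
Qed.

(** Moves the orientation from edges to vertices, so that it can be propagated along a central
    class. Some edge at [i] being flipped will mean that all are. *)
Definition vertex_flipped i :=
  [exists j, (i != j) && (rho i j && flipped i j || rho j i && flipped j i)].

(** A second edge at the same vertex is the reverse edge, has the same source, has the same target,
    or composes with the first; each case is one of the preceding lemmas. *)
Lemma vertex_flipped_edge i j : rho i j -> i != j ->
  vertex_flipped i = flipped i j /\ vertex_flipped j = flipped i j.
Proof.
move=> rij ij; have ji : j != i by rewrite eq_sym.
split.
  apply/existsP/idP => [[k /andP[ik]]|f]; last first.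
    by exists j; rewrite ij rij f.
  have [->|kj] := eqVneq k j.
    by case/orP=> /andP[r f] //; rewrite (flipped_sym rij r).
  case/orP=> /andP[r f].
    by rewrite (flipped_source rij r) // eq_sym.
  by rewrite -(flipped_comp r rij) // eq_sym.
apply/existsP/idP => [[k /andP[jk]]|f]; last first.
  by exists i; rewrite ji rij f orbT.
have [->|ki] := eqVneq k i.
  by case/orP=> /andP[r f] //; rewrite (flipped_sym rij r).
case/orP=> /andP[r f].
  by rewrite (flipped_comp rij r) // eq_sym.
by rewrite (flipped_target rij r) // eq_sym.
Qed.

Lemma vertex_flipped_rho i j : rho i j -> vertex_flipped i = vertex_flipped j.
Proof.
have [-> //|ij rij] := eqVneq i j.
by have [-> ->] := vertex_flipped_edge rij ij.
Qed.

Lemma psi_delta_scale t i j : rho i j -> i != j ->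
  psi (t *: E i j) i j = psi (E i j) i j * diag_action i t.
Proof.
move=> rij ij; have ji : j != i by rewrite eq_sym.
have e : jordan (t *: E i i) (E i j) = t *: E i j.
  rewrite /= -scalemxAl -scalemxAr mul_delta_mx mul_delta_mx_0 //.
  by rewrite scaler0 addr0.
rewrite -e psi_jordan_delta // !eqxx (negPf ij) (negPf ji).
rewrite (psi_diag_scale _ ij).
by rewrite /diag_action /=; ring.
Qed.

(** The argument depends on which of (i,j) and (j,i) lie in [rho]. *)
Lemma psi_straightE X i j : has_neighbour i -> ~~ vertex_flipped i -> X \in A ->
  psi X i j = psi (E i j) i j * diag_action i (X i j).
Proof.
move=> hi nf hX.
have [<-|ij] := eqVneq i j; first by rewrite psiE mxE !eqxx mul1r psi_diagE.
have ji : j != i by rewrite eq_sym.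
have [rij|nij] := boolP (rho i j).
  have [vf _] := vertex_flipped_edge rij ij; rewrite vf in nf.
  have [rji|nji] := boolP (rho j i).
    (* Both pairs: [psi_swap] along (j,i) expresses the action on X_ij through the wanted entry, and
       the coefficients of the two edges are mutually inverse. *)
    have := nf; rewrite (flipped_sym rij rji ij) => /negbNE/eqP y'0.
    have /negbNE/eqP y0 := nf.
    have := psi_delta_swap rij rji ij; rewrite y0 mul0r addr0 => e.
    rewrite (diag_action_rho rij) (psi_swap rji ji hX) y'0 mul0r addr0.
    by rewrite mulrA e mul1r.
  (* Now X_ji = 0, so [X] agrees with [X i j *: E i j] at both positions. *)
  rewrite -psi_delta_scale //; apply: psi_offdiag_local; rewrite ?memvZ ?EA //.
    by rewrite !mxE !eqxx mulr1.
  by rewrite !mxE (negPf ij) andbF mulr0; move/smaP: hX => ->.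
have Xij : X i j = 0 by move/smaP: hX => ->.
rewrite Xij diag_action0 mulr0.
have [rji|nji] := boolP (rho j i); last first.
  by rewrite psi_offdiag0 //; move/smaP: hX => ->.
(* Only (j,i): [psi_swap] reduces to 0 being the wanted entry times a non-zero coefficient. *)
have [_ vf] := vertex_flipped_edge rji ji; rewrite vf in nf.
have := psi_swap rji ji hX; rewrite Xij diag_action0.
have /negbNE/eqP -> := nf; rewrite mul0r addr0 => /esym/eqP.
by rewrite mulf_eq0 -flippedN // (negPf nf) => /eqP.
Qed.

End FixPsi.

(** Apply [psi_straightE] to the transposed map, for which the vertex is no longer flipped. *)
Lemma psi_flippedE psi X i j : jordan_fixing_diag psi ->
  has_neighbour i -> vertex_flipped psi i -> X \in A ->
  psi X j i = psi (E i j) j i * diag_action psi i (X i j).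
Proof.
move=> hpsi hi fi hX; have hT := jordan_fixing_diag_tr hpsi.
have := @psi_straightE _ hT X i j hi _ hX; rewrite /diag_action !mxE; apply.
case: hi => k ik /orP[r|r]; last rewrite eq_sym in ik.
  have [-> _] := vertex_flipped_edge hT r ik.
  have [e _] := vertex_flipped_edge hpsi r ik.
  by rewrite /flipped mxE negbK -flippedN // -e.
have [_ ->] := vertex_flipped_edge hT r ik.
have [_ e] := vertex_flipped_edge hpsi r ik.
by rewrite /flipped mxE negbK -flippedN // -e.
Qed.

(** The non-zero coefficient of the image of [E i j], from which [g] is built. *)
Definition edge_coef psi i j :=
  if vertex_flipped psi i then psi (E i j) j i else psi (E i j) i j.

Lemma edge_coef_neq0 psi i j : jordan_fixing_diag psi -> rho i j ->
  edge_coef psi i j != 0.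
Proof.
move=> hpsi rij; rewrite /edge_coef.
have [<-|ij] := eqVneq i j.
  by case: hpsi => _ _ ->; rewrite mxE !eqxx /= if_same oner_eq0.
have [-> _] := vertex_flipped_edge hpsi rij ij.
by case: ifPn; rewrite // flippedN.
Qed.

(** For distinct indices this is [psi_delta_comp]; for i = k it is [psi_delta_swap]. *)
Lemma edge_coef_trans psi i j k : jordan_fixing_diag psi ->
  rho i j -> rho j k ->
  edge_coef psi i j * edge_coef psi j k = edge_coef psi i k.
Proof.
move=> hpsi rij rjk; rewrite /edge_coef -(vertex_flipped_rho hpsi rij).
have pE l : psi (E l l) l l = 1 by case: hpsi => _ _ ->; rewrite mxE !eqxx.
have [<-|ij] := eqVneq i j; first by rewrite pE if_same mul1r.
have [<-|jk] := eqVneq j k; first by rewrite pE if_same mulr1.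
have [e|ik] := eqVneq i k.
  rewrite -e in rjk *; rewrite pE if_same.
  have ji : j != i by rewrite eq_sym.
  have := psi_delta_swap hpsi rij rjk ij.
  have [-> _] := vertex_flipped_edge hpsi rij ij; case: ifPn => f.
    have := f; rewrite flippedN // => /eqP-> /=; by rewrite mul0r add0r.
  by have /negbNE/eqP -> := f; rewrite mul0r addr0.
by have [-> ->] := psi_delta_comp hpsi rij rjk ij jk ik; case: ifP.
Qed.

End JordanEntries.


(** * Reduction of the normalized Jordan product to the Jordan product *)

Section Normalized.
Variables (F : fieldType) (n : nat) (rho : rel 'I_n).
Hypotheses (F2 : (2 : F) != 0) (rho_qo : quasi_order rho).
Hypothesis neighbours : forall i, has_neighbour rho i.
Notation A := (sma F rho).
Notation E := (@delta_mx F n n).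
Notation njordan := (@bullet F n NormalizedJordan).
Implicit Types (X Y : 'M[F]_n) (i j k a b : 'I_n).

Variable psi : 'M[F]_n -> 'M[F]_n.
Hypotheses (hpsi : injective_hom rho NormalizedJordan psi) (psi0 : psi 0 = 0).
Hypothesis psiE : forall i, psi (E i i) = E i i.

Let EA i j : rho i j -> E i j \in A. Proof. exact: delta_mx_sma. Qed.

Let EEA i : E i i \in A. Proof. exact: delta_mx_diag_sma. Qed.

Let V2 : (2^-1 : F) != 0. Proof. by rewrite invr_eq0. Qed.

Lemma njordan_delta_diagE X k a b :
  njordan X (E k k) a b = 2^-1 * (((a == k)%:R + (b == k)%:R) * X a b).
Proof. by rewrite mxE -jordan_delta_diagE. Qed.

Let psiM : {in A &, {morph psi : X Y / njordan X Y}}.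
Proof. by case: hpsi. Qed.

Lemma psi_njordan_delta_diag X k a b : X \in A ->
  psi (njordan X (E k k)) a b =
    2^-1 * (((a == k)%:R + (b == k)%:R) * psi X a b).
Proof. by move=> hX; rewrite psiM // psiE njordan_delta_diagE. Qed.

Lemma njordan_scalar (c : F) X : njordan c%:M X = c *: X.
Proof.
rewrite /= mul_scalar_mx mul_mx_scalar -mulr2n -(scaler_nat 2 (c *: X)).
by rewrite [LHS]scalerA mulVf // scale1r.
Qed.

(** The products of [t *: E i j] with [E i i] and with [E j j] are both half of it. Equating their
    images confines the support to (i,j) and (j,i), where the factor is exactly 1/2. *)
Lemma psi_half_edge i j t : rho i j -> i != j ->
  psi (2^-1 *: (t *: E i j)) = 2^-1 *: psi (t *: E i j) /\
  forall a b, psi (t *: E i j) a b != 0 -> (a, b) = (i, j) \/ (a, b) = (j, i).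
Proof.
move=> rij ij; have ji : j != i by rewrite eq_sym.
have tA u : u *: E i j \in A by rewrite memvZ ?EA.
have e u k : k \in [:: i; j] ->
    njordan (u *: E i j) (E k k) = 2^-1 *: (u *: E i j).
  rewrite !inE => hk; rewrite /= -scalemxAl -scalemxAr.
  case/orP: hk => /eqP->; rewrite mul_delta_mx mul_delta_mx_0 //.
    by rewrite scaler0 add0r.
  by rewrite scaler0 addr0.
have h u k a b : k \in [:: i; j] -> psi (2^-1 *: (u *: E i j)) a b =
    2^-1 * (((a == k)%:R + (b == k)%:R) * psi (u *: E i j) a b).
  by move=> hk; rewrite -(e u k hk) psi_njordan_delta_diag.
have hi u a b := h u i a b (mem_head _ _).
have hj u a b := h u j a b (mem_last i [:: j]).
have one u a b : psi (2^-1 *: (u *: E i j)) a b != 0 ->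
    (a, b) = (i, j) \/ (a, b) = (j, i).
  have := hj u a b; rewrite hi; move: (psi _ a b) => v.
  have [->|ai] := eqVneq a i; have [->|bi] := eqVneq b i;
    rewrite ?(negPf ij) ?(negPf ji) /=.
  - by rewrite /= !(addr0, add0r) mul0r mulr0 => ->; rewrite eqxx.
  - have [->|bj] := eqVneq b j; first by left.
     by rewrite /= !(addr0, add0r) mul0r mulr0 => ->; rewrite eqxx.
  - have [->|aj] := eqVneq a j; first by right.
    by rewrite /= !(addr0, add0r) mul0r mulr0 => ->; rewrite eqxx.
  - by rewrite addr0 mul0r mulr0 eqxx.
(* Applying [one] to [2 * u] removes the factor 1/2. *)
have supp u a b : psi (u *: E i j) a b != 0 ->
    (a, b) = (i, j) \/ (a, b) = (j, i).
  by have := one (2 * u) a b; rewrite scalerA mulKf.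
split; last exact: supp.
apply/matrixP => a b; rewrite hi [RHS]mxE; congr (_ * _).
have [->|/supp[[-> ->]|[-> ->]]] := eqVneq (psi (t *: E i j) a b) 0.
- by rewrite mulr0.
- by rewrite eqxx (negPf ji) addr0 mul1r.
- by rewrite eqxx (negPf ji) add0r mul1r.
Qed.

Lemma half_of_squares (x y : F) : x + y = 1 -> x * x + y * y = 2^-1 -> x = 2^-1.
Proof.
move=> xy xxyy; apply: (mulfI F2); rewrite mulfV //.
have /eqP : (x - y) * (x - y) = 0.
  transitivity (2 * (x * x + y * y) - (x + y) * (x + y)); first by ring.
  by rewrite xy xxyy mulfV // mulr1 subrr.
by rewrite mulf_eq0 orbb subr_eq0 => /eqP e; rewrite -[RHS]xy -e; ring.
Qed.

(** Halving is the product with the scalar matrix 1/2, so it suffices that its image [D] is again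
    that matrix. *)
Lemma psi_half X : X \in A -> psi (2^-1 *: X) = 2^-1 *: psi X.
Proof.
move=> hX; pose D := psi (2^-1)%:M.
have IA (c : F) : c%:M \in A := scalar_mx_sma rho_qo c.
(* Half of [E k k] is the product of [E k k] with the scalar 1/2 and also with half of [E k k].
   Comparing the two shows that the entry (k,b) of [D] is half of itself. *)
have D0 k b : b != k -> D k b = 0.
  move=> bk.
  have e1 := psi_njordan_delta_diag k k b (IA 2^-1).
  have e2 := psi_njordan_delta_diag k k b (memvZ 2^-1 (EEA k)).
  move: e1 e2; rewrite -/D njordan_scalar.
  have -> : njordan (2^-1 *: E k k) (E k k) = 2^-1 *: E k k.
    rewrite -[in RHS]njordan_scalar /= mul_scalar_mx mul_mx_scalar.
    by rewrite -scalemxAl -scalemxAr mul_delta_mx.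
  rewrite eqxx (negPf bk) /= addr0 !mul1r => -> /(mulfI V2) e.
  have : D k b * 2 = D k b by rewrite {1}e mulrAC mulVf // mul1r.
  by rewrite -[RHS]addr0 mulr_natr mulr2n => /addrI.
have DX (d : 'I_n -> F) Y a b :
    (bullet NormalizedJordan (\matrix_(k, l) (d k *+ (k == l))) Y) a b =
    2^-1 * ((d a + d b) * Y a b).
  rewrite !mxE (bigD1 a) //= big1 ?addr0 => [|k ka].
    rewrite (bigD1 b) //= big1 ?addr0 => [|k kb].
      by rewrite !mxE !eqxx !mulr1n; congr (_ * _); ring.
    by rewrite !mxE (negPf kb) mulr0n mulr0.
  by rewrite !mxE eq_sym (negPf ka) mulr0n mul0r.
have ED : D = \matrix_(k, l) ((fun k => D k k) k *+ (k == l)).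
  apply/matrixP => k l; rewrite [RHS]mxE; have [->|kl] := eqVneq k l.
    by rewrite mulr1n.
  by rewrite D0 ?mulr0n // eq_sym.
have DD : psi (2^-1 * 2^-1)%:M =
    \matrix_(k, l) ((fun k => D k k * D k k) k *+ (k == l)).
  have -> : (2^-1 * 2^-1)%:M = njordan (2^-1)%:M (2^-1)%:M.
    by rewrite njordan_scalar scale_scalar_mx.
  rewrite psiM ?IA // -/D; apply/matrixP => k l.
  rewrite {1}ED DX !mxE; have [->|kl] := eqVneq k l.
    by rewrite mulr1n; field.
  by rewrite (D0 k l) ?mulr0n ?mulr0 // eq_sym.
have Dhalf i : D i i = 2^-1.
  (* The products of [E k l] with the scalars 1/2 and 1/4 give the sum of the two diagonal entries
     and the sum of their squares. *)
  have edge k l : rho k l -> k != l -> D k k = 2^-1 /\ D l l = 2^-1.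
    move=> rkl kl; have [h1 supp] := psi_half_edge 1 rkl kl.
    have [h2 _] := psi_half_edge 2^-1 rkl kl.
    rewrite scale1r in h1 supp.
    have [a [b Wab]] : exists a, exists b, psi (E k l) a b != 0.
      have /matrix0Pn[a [b ?]] : psi (E k l) != 0; last by exists a, b.
      rewrite -psi0; apply: contraTneq (EA rkl) => /hpsi.1 e.
      have /matrixP/(_ k l) := e (EA rkl) (mem0v _).
      by rewrite !mxE !eqxx => /eqP; rewrite oner_eq0.
    have sym (d : 'I_n -> F) : d a + d b = d k + d l.
      by case: (supp a b Wab) => [[-> ->]|[-> ->]]; rewrite // addrC.
    have s1 : D k k + D l l = 1.
      rewrite -(sym (fun k => D k k)); apply: (mulIf Wab); apply: (mulfI V2).
      rewrite -(DX (fun k => D k k)) -ED -psiM ?IA ?EA // njordan_scalar h1.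
      by rewrite mxE mul1r.
    have s2 : D k k * D k k + D l l * D l l = 2^-1.
      rewrite -(sym (fun k => D k k * D k k)).
      apply: (mulIf Wab); apply: (mulfI V2).
      rewrite -(DX (fun k => D k k * D k k)) -DD -psiM ?IA ?EA //.
      rewrite njordan_scalar -scalerA.
      by rewrite h2 h1 !mxE.
    split; first exact: half_of_squares s1 s2.
    by apply: (@half_of_squares _ (D k k)); rewrite addrC.
  have [j ij /orP[rij|rji]] := neighbours i.
    by have [] := edge i j rij ij.
  by rewrite eq_sym in ij; have [] := edge j i rji ij.
apply/matrixP => a b.
rewrite -(njordan_scalar 2^-1 X) psiM ?IA // -/D ED DX /= !Dhalf.
by rewrite mxE; field.
Qed.

Lemma jordan_of_normalized : jordan_fixing_diag rho psi.
Proof.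
split=> //; split=> [|X Y hX hY]; first by case: hpsi.
have /= := psiM hX hY; rewrite psi_half ?jordan_sma //.
exact: scalerI.
Qed.

End Normalized.


(** * From entrywise formulas to the standard form *)

Lemma additive_multiplicative_rmorphism (F : fieldType) (f : F -> F) :
  {morph f : x y / x + y} -> {morph f : x y / x * y} -> f 1 = 1 ->
  exists w : {rmorphism F -> F}, w =1 f.
Proof.
move=> fD fM f1.
have f0 : f 0 = 0 by apply: (addIr (f 0)); rewrite -fD !add0r.
have fN x : f (- x) = - f x by apply: (addIr (f x)); rewrite -fD !addNr.
have fB : zmod_morphism f by move=> x y; rewrite fD fN.
have fm : monoid_morphism f by split.
pose aM := GRing.isZmodMorphism.Build F F f fB.
pose mM := GRing.isMonoidMorphism.Build F F f fm.
pose w : {rmorphism F -> F} := HB.pack f aM mM.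
by exists w.
Qed.

Section Assembly.
Variables (F : fieldType) (n : nat) (rho : rel 'I_n).
Hypothesis rho_qo : quasi_order rho.
Notation A := (sma F rho).
Implicit Types (X Y : 'M[F]_n) (i j k : 'I_n) (c : {set 'I_n}).

Definition has_standard_form op (phi : 'M[F]_n -> 'M[F]_n) :=
  exists (T : 'M[F]_n) (g : 'I_n -> 'I_n -> F)
         (omega : {set 'I_n} -> {rmorphism F -> F}) (dag : {set 'I_n} -> bool),
    [/\ T \in unitmx,
        transitive_map rho g,
        op = Standard ->
          forall c, c \in central_classes rho -> dag c = false &
        {in A, forall X, phi X = standard_form rho T g omega dag X}].

Lemma central_rel_invariant (T : eqType) (u : 'I_n -> T) i j :
  (forall k l, rho k l -> u k = u l) -> central_rel rho i j -> u i = u j.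
Proof.
move=> hu cij.
have cl : closed [rel i j | rho i j || rho j i] [pred k | u k == u i].
  by move=> k l /= /orP[/hu|/hu] e; rewrite !inE e.
by have := closed_connect cl cij; rewrite !inE eqxx => /esym/eqP.
Qed.

Lemma central_idem_mulmxE c X i j :
  (central_idem F c *m X) i j = if i \in c then X i j else 0.
Proof.
rewrite /central_idem mulmx_suml summxE.
case: ifPn => ic.
  rewrite (bigD1 i) //= delta_mulmxE eqxx mul1r big1 ?addr0 // => k /andP[_ ki].
  by rewrite delta_mulmxE eq_sym (negPf ki) mul0r.
rewrite big1 // => k kc; rewrite delta_mulmxE.
case: eqP => [e|]; rewrite ?mul0r //.
by rewrite e kc in ic.
Qed.

(** Data indexed by vertices and invariant along [rho] descend to central classes; this serves all
    three products. *)
Lemma standard_form_of_entries op (phi : 'M[F]_n -> 'M[F]_n) (T : 'M[F]_n)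
    (h : 'I_n -> 'I_n -> F) (s : 'I_n -> bool) (f : 'I_n -> F -> F) :
  T \in unitmx ->
  (forall i j, rho i j -> h i j != 0) ->
  (forall i j k, rho i j -> rho j k -> h i j * h j k = h i k) ->
  (forall i j, rho i j -> s i = s j) ->
  (op = Standard -> forall i, s i = false) ->
  (forall i j, rho i j -> f i =1 f j) ->
  (forall i, {morph f i : x y / x + y}) ->
  (forall i, {morph f i : x y / x * y}) ->
  (forall i, f i 1 = 1) ->
  (forall X i j, X \in A -> (invmx T *m phi X *m T) i j =
     if s i then h j i * f i (X j i) else h i j * f i (X i j)) ->
  has_standard_form op phi.
Proof.
move=> Tu h0 htr srho sop frho fD fM f1 hphi.
have [rrefl rtr] := rho_qo.
have hii i : h i i = 1.
  by apply: (mulfI (h0 i i (rrefl i))); rewrite htr ?rrefl ?mulr1.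
have hinv i j : rho i j -> rho j i -> (h i j)^-1 = h j i.
  by move=> rij rji; apply: mulr1_eq; rewrite htr.
have fi0 i : f i 0 = 0 by apply: (addIr (f i 0)); rewrite -fD !add0r.
have /fin_all_exists[w hw] i : exists w : {rmorphism F -> F}, w =1 f i.
  exact: additive_multiplicative_rmorphism.
(* Any member of the class serves as representative; [idfun] is a default for the empty set, which
   is not a class. *)
pose omega c : {rmorphism F -> F} :=
  if [pick i in c] is Some i then w i else idfun.
pose dag c := [exists i in c, s i].
(* On a transposed class [gstar] meets the entry X_ji at (i,j) and scales it by the inverse of
   [g j i], so the coefficients have to be inverted. *)
pose g i j := if s i then (h i j)^-1 else h i j.
have cls i c : c = central_class rho i -> omega c =1 f i /\ dag c = s i.
  move=> ->; split=> [t|].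
    rewrite /omega; case: pickP => [k|/(_ i)]; last by rewrite central_class_id.
    rewrite inE hw => /(central_rel_invariant (u := fun l => f l t)) -> //.
    by move=> k' l /frho.
  apply/exists_inP/idP => [[k]|si]; last by exists i; rewrite ?central_class_id.
  by rewrite inE => /(central_rel_invariant srho) ->.
exists T, g, omega, dag; split => //.
- split=> [i j rij|i j k rij rjk]; rewrite /g.
    by case: ifP; rewrite ?invr_eq0 h0.
  by rewrite -(srho i j rij); case: ifP; rewrite -?invfM htr.
- move=> st c hc; have /central_classesP[i /cls[_ ->]] := hc; exact: sop.
move=> X hX.
have X0 i j : X i j != 0 -> rho i j.
  by apply: contraNT => nij; apply/eqP; move/smaP: hX => ->.
rewrite /standard_form; set S := \sum_(c in _) _.
suff -> : gstar rho g S = invmx T *m phi X *m T.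
  by rewrite !mulmxA mulmxV // mul1mx mulmxK.
have mapE c k l : map_mx (omega c) (central_idem F c *m X) k l =
    if k \in c then omega c (X k l) else 0.
  by rewrite mxE central_idem_mulmxE; case: ifP; rewrite ?rmorph0.
have SE i j : S i j = if s i then f i (X j i) else f i (X i j).
  have ci : central_class rho i \in central_classes rho.
    by apply/central_classesP; exists i.
  have [om dg] := cls i _ erefl.
  rewrite /S summxE (bigD1 (central_class rho i)) //= big1 ?addr0.
    rewrite /dagger dg; case: ifP => _.
      rewrite mxE mapE om.
      have [->|/X0 rji] := eqVneq (X j i) 0; first by rewrite fi0 if_same.
      by rewrite -(central_class_rho rji) central_class_id.
    by rewrite mapE om central_class_id.
  (* Other classes contribute 0 to row [i], even transposed: a non-zero X_ji puts [j] in the class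
     of [i]. *)
  move=> c /andP[hc ci']; rewrite /dagger.
  have nic : i \in c = false by rewrite (mem_central_class _ hc) (negPf ci').
  case: ifP => _; last by rewrite mapE nic.
  rewrite mxE mapE; case: ifP => // jc.
  have [->|/X0 rji] := eqVneq (X j i) 0; first by rewrite rmorph0.
  move: jc; rewrite (mem_central_class _ hc) (central_class_rho rji).
  by rewrite (negPf ci').
apply/matrixP => i j; rewrite mxE SE hphi //; case: (boolP (s i)) => si.
  have [->|/X0 rji] := eqVneq (X j i) 0; first by rewrite fi0 !mulr0.
  congr (_ * _); rewrite /g (srho j i rji) si invrK.
  by case: ifP => // rij; apply: hinv.
have [->|/X0 rij] := eqVneq (X i j) 0; first by rewrite fi0 !mulr0.
by rewrite rij /g (negPf si).
Qed.

End Assembly.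


(** * Conjugation to fix the diagonal units, and the two Jordan products *)

Section Conjugation.
Variables (F : fieldType) (n : nat) (rho : rel 'I_n).
Hypotheses (F2 : (2 : F) != 0) (rho_qo : quasi_order rho).
Notation A := (sma F rho).
Notation E := (@delta_mx F n n).
Implicit Types (X Y T : 'M[F]_n) (i j k : 'I_n) (phi : 'M[F]_n -> 'M[F]_n).

(** The hypothesis says that [X] and [Y - 1%:M] have Jordan product 0, so [idempotent_jordan0]
    applies. *)
Lemma njordan_idem X Y : X *m X = X ->
  bullet NormalizedJordan X Y = X -> X *m Y = X /\ Y *m X = X.
Proof.
move=> XX h.
have [|h1 h2] := @idempotent_jordan0 F n X (Y - 1%:M) F2 XX.
  apply: (scalerI (a := 2^-1)); first by rewrite invr_eq0.
  rewrite mulmxBr mulmxBl mulmx1 mul1mx addrACA -opprD scalerBr scaler0.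
  move: h => /= ->; rewrite -mulr2n -(scaler_nat 2 X) scalerA mulVf //.
  by rewrite scale1r subrr.
split; apply/eqP; rewrite -subr_eq0.
  by rewrite -[X in _ - X]mulmx1 -mulmxBr h1.
by rewrite -[X in _ - X]mul1mx -mulmxBl h2.
Qed.

(** The Jordan product is excluded because it sends [E i i] and itself to twice [E i i]. For the
    other two, idempotents are preserved and [idempotents_over_diag] applies. *)
Lemma hom_diag op phi : op <> Jordan -> injective_hom rho op phi ->
  phi 0 = 0 /\
  exists2 T, T \in unitmx & forall i, phi (E i i) = T *m E i i *m invmx T.
Proof.
move=> opJ [inj mor].
have EA i : E i i \in A by exact: delta_mx_diag_sma.
have A0 : 0 \in A := mem0v A.
have b0l X : bullet op 0 X = 0.
  by case: op {mor opJ} => /=; rewrite mul0mx ?mulmx0 ?addr0 ?scaler0.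
have bE i j : i != j -> bullet op (E i i) (E j j) = 0.
  move=> ij; have ji : j != i by rewrite eq_sym.
  by case: op {mor opJ b0l} => /=; rewrite !mul_delta_mx_0 // ?addr0 ?scaler0.
have idem X : X *m X = X -> bullet op X X = X.
  case: op opJ {mor b0l bE} => //= _ ->; rewrite -mulr2n -(scaler_nat 2 X).
  by rewrite scalerA mulVf // scale1r.
have mulE X : bullet op X X = X *m X.
  case: op opJ {mor b0l bE idem} => //= _; rewrite -mulr2n.
  by rewrite -(scaler_nat 2 (X *m X)) scalerA mulVf // scale1r.
have phi_idem X : X \in A -> X *m X = X -> phi X *m phi X = phi X.
  by move=> hX XX; rewrite -mulE -mor // idem.
have ZZ := phi_idem _ A0 (mul0mx _ _).
have EE i : phi (E i i) *m phi (E i i) = phi (E i i).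
  by apply: phi_idem => //; rewrite mul_delta_mx.
have PZ i : phi 0 *m phi (E i i) = phi 0 /\ phi (E i i) *m phi 0 = phi 0.
  have := mor _ _ A0 (EA i); rewrite b0l => h.
  case: op opJ {b0l bE idem mulE} mor h => // _ mor h; last first.
    exact: njordan_idem.
  by split=> //; have := mor _ _ (EA i) A0; rewrite /= mulmx0.
have PP i j : i != j -> phi (E i i) *m phi (E j j) = phi 0.
  move=> ij; have := mor _ _ (EA i) (EA j); rewrite bE //.
  case: op opJ {b0l bE idem mulE} mor => // _ mor h //.
  (* Subtracting [phi 0] turns a Jordan product equal to [2 *: phi 0] into one equal to 0. *)
  have [||h1 _] := @idempotent_jordan0 F n (phi (E i i) - phi 0)
      (phi (E j j) - phi 0) F2.
  - rewrite mulmxBl !mulmxBr EE ZZ; have [-> ->] := PZ i.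
    by rewrite subrr subr0.
  - rewrite !mulmxBl !mulmxBr ZZ; have [-> ->] := PZ i; have [-> ->] := PZ j.
    rewrite subrr !subr0 addrACA -opprD; apply/eqP; rewrite subr_eq0.
    move: h => /= /esym h; apply/eqP.
    apply: (scalerI (a := 2^-1)); first by rewrite invr_eq0.
    rewrite h -mulr2n -(scaler_nat 2 (phi 0)) scalerA mulVf //.
    by rewrite scale1r.
  move: h1; rewrite mulmxBl !mulmxBr ZZ; have [_ ->] := PZ i.
  have [-> _] := PZ j; rewrite subrr subr0 => /eqP; rewrite subr_eq0.
  by move/eqP.
apply: (@idempotents_over_diag F n (fun i => phi (E i i))) => //.
- by move=> i; case: (PZ i).
- by move=> i; case: (PZ i).
move=> i; apply/eqP => /(inj _ _ (EA i) A0)/matrixP/(_ i i).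
by rewrite !mxE !eqxx => /eqP; rewrite oner_eq0.
Qed.

Lemma conj_hom op phi T : T \in unitmx -> injective_hom rho op phi ->
  injective_hom rho op (fun X => invmx T *m phi X *m T).
Proof.
move=> Tu [inj mor]; split=> [X Y hX hY e|X Y hX hY].
  apply: inj => //; have := congr1 (fun Z => T *m Z *m invmx T) e.
  by rewrite !mulmxA mulmxV // !mul1mx !mulmxK.
have conjM B C : invmx T *m (B *m C) *m T =
    invmx T *m B *m T *m (invmx T *m C *m T).
  by rewrite !mulmxA mulmxK.
rewrite mor //; case: op {mor} => /=; rewrite -?conjM //.
  by rewrite mulmxDr mulmxDl.
by rewrite -scalemxAr -scalemxAl mulmxDr mulmxDl.
Qed.

Lemma fixing_diag op phi : op <> Jordan -> injective_hom rho op phi ->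
  exists T, let psi X := invmx T *m phi X *m T in
    [/\ T \in unitmx, injective_hom rho op psi, psi 0 = 0
       & forall i, psi (E i i) = E i i].
Proof.
move=> opJ hphi; have [p0 [T Tu pE]] := hom_diag opJ hphi; exists T.
split=> //; first exact: conj_hom.
  by rewrite p0 mulmx0 mul0mx.
by move=> i; rewrite pE !mulmxA mulVmx // mul1mx mulmxKV.
Qed.

Hypothesis neighbours : forall i, has_neighbour rho i.

Lemma normalized_standard_form phi :
  injective_hom rho NormalizedJordan phi ->
  has_standard_form rho NormalizedJordan phi.
Proof.
move=> hphi; have [|T /= [Tu hpsi p0 pE]] := fixing_diag _ hphi; first by [].
have hJ := jordan_of_normalized F2 rho_qo neighbours hpsi p0 pE.
set psi := fun X => _ in hpsi p0 pE hJ.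
apply: (standard_form_of_entries rho_qo Tu (h := edge_coef rho psi)
  (s := vertex_flipped rho psi) (f := diag_action psi)) => //.
- by move=> i j; apply: edge_coef_neq0.
- by move=> i j k; apply: edge_coef_trans.
- by move=> i j; apply: vertex_flipped_rho.
- by move=> i j; apply: diag_action_rho.
- by move=> i; apply: (diag_actionD F2 rho_qo hJ).
- by move=> i; apply: (diag_actionM F2 rho_qo hJ).
- by move=> i; apply: (diag_action1 hJ).
move=> X i j hX; rewrite -/(psi X).
have X0 k l : ~~ rho k l -> X k l = 0 by move/smaP: hX; apply.
have d0 k : diag_action psi k 0 = 0 by rewrite (diag_action0 hJ).
case: ifPn => si; last first.
  by rewrite (psi_straightE F2 rho_qo hJ) // /edge_coef (negPf si).
(* The entry (i,j) is obtained from [psi_flippedE] at the vertex [j]; an edge between [i] and [j]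
   carries the flag over. *)
have [rji|nji] := boolP (rho j i).
  have e := vertex_flipped_rho F2 rho_qo hJ rji.
  rewrite (psi_flippedE F2 rho_qo _ hJ) ?e // /edge_coef e si.
  by rewrite (diag_action_rho F2 rho_qo hJ rji).
rewrite X0 // d0 mulr0.
have ij : i != j by apply: contraNneq nji => ->; case: rho_qo => + _; apply.
have [rij|nij] := boolP (rho i j); last first.
  by rewrite (psi_offdiag0 rho_qo hJ) // X0.
rewrite (psi_flippedE F2 rho_qo _ hJ) // ?X0 ?d0 ?mulr0 //.
by rewrite -(vertex_flipped_rho F2 rho_qo hJ rij).
Qed.

Lemma standard_form_add T g omega dag X Y :
  standard_form rho T g omega dag (X + Y) =
  standard_form rho T g omega dag X + standard_form rho T g omega dag Y.
Proof.
rewrite /standard_form -mulmxDl -mulmxDr; congr (_ *m _ *m _).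
rewrite -[gstar rho g (\sum_(c in _) dagger _ (map_mx _ (_ *m X)))]scale1r.
rewrite -gstar_linear scale1r -big_split /=; congr gstar; apply: eq_bigr => c _.
by rewrite /dagger mulmxDr map_mxD; case: ifP; rewrite ?linearD.
Qed.

(** Rescaling to [2 *: phi (2^-1 *: X)] gives a homomorphism for the normalized product. Additivity
    of its standard form then recovers [phi] from the value at [X + X]. *)
Lemma jordan_standard_form phi :
  injective_hom rho Jordan phi -> has_standard_form rho Jordan phi.
Proof.
move=> [inj mor]; pose psi X := 2 *: phi (2^-1 *: X).
have V2 : (2^-1 : F) != 0 by rewrite invr_eq0.
have hpsi : injective_hom rho NormalizedJordan psi.
  split=> [X Y hX hY /(scalerI F2)/inj h|X Y hX hY].
    by apply: (scalerI V2); apply: h; rewrite memvZ.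
  rewrite /psi /=.
  have -> : 2^-1 *: (2^-1 *: (X *m Y + Y *m X)) =
      bullet Jordan (2^-1 *: X) (2^-1 *: Y).
    by rewrite /= -!scalemxAl -!scalemxAr -!scalerDr.
  rewrite mor ?memvZ //= -!scalemxAl -!scalemxAr -!scalerDr.
  rewrite [RHS]scalerA mulVf //.
  by rewrite scale1r.
have [T [g [omega [dag [Tu tg _ e]]]]] := normalized_standard_form hpsi.
exists T, g, omega, dag; split=> // X hX.
have e2 : psi (X + X) = 2 *: phi X.
  by rewrite /psi -mulr2n -(scaler_nat 2 X) scalerA mulVf // scale1r.
apply: (scalerI F2); rewrite -e2 e ?memvD // standard_form_add.
by rewrite -mulr2n -scaler_nat.
Qed.


End Conjugation.


(** * Multiplicative maps, and the three products together *)

Section Multiplicative.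
Variables (F : fieldType) (n : nat) (rho : rel 'I_n).
Hypotheses (F2 : (2 : F) != 0) (rho_qo : quasi_order rho).
Hypothesis neighbours : forall i, has_neighbour rho i.
Notation A := (sma F rho).
Notation E := (@delta_mx F n n).
Implicit Types (X Y T : 'M[F]_n) (i j k : 'I_n) (phi : 'M[F]_n -> 'M[F]_n).

(** The matrix [E i i *m X *m E j j] retains only the entry (i,j), in its place, so the map acts
    entrywise and never transposes. *)
Lemma multiplicative_standard_form phi :
  injective_hom rho Standard phi -> has_standard_form rho Standard phi.
Proof.
move=> hphi; have [|T /= [Tu [inj mor] p0 pE]] := fixing_diag F2 rho_qo _ hphi.
  by [].
pose psi X := invmx T *m phi X *m T.
have psiM X Y : X \in A -> Y \in A -> psi (X *m Y) = psi X *m psi Y := @mor X Y.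
have {p0}psi0 : psi 0 = 0 by [].
have {pE}psiE i : psi (E i i) = E i i by exact: pE.
have EA i j : rho i j -> E i j \in A by exact: delta_mx_sma.
have EEA i : E i i \in A by exact: delta_mx_diag_sma.
have tA t i j : rho i j -> t *: E i j \in A by move=> rij; rewrite memvZ ?EA.
have rii i : rho i i by case: rho_qo => + _; apply.
have corner X i j : E i i *m X *m E j j = X i j *: E i j.
  apply/matrixP => a b; rewrite mulmx_deltaE delta_mulmxE !mxE mulrAC mulrC.
  by rewrite -natrM mulnb.
have psi_corner X i j : X \in A -> psi (X i j *: E i j) = psi X i j *: E i j.
  by move=> hX; rewrite -!corner !psiM ?mulmx_sma // !psiE.
have tE t i j : (t *: E i j) i j = t by rewrite !mxE !eqxx mulr1.
have psi_scale t i j : rho i j ->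
    psi (t *: E i j) = psi (t *: E i j) i j *: E i j.
  by move=> rij; rewrite -psi_corner ?tA // tE.
pose h i j := psi (E i j) i j; pose f i t := psi (t *: E i i) i i.
have psi_delta i j : rho i j -> psi (E i j) = h i j *: E i j.
  by move=> rij; have := psi_scale 1 i j rij; rewrite scale1r.
(* The scalar t can be absorbed on the left into [E i i] or on the right into [E j j]; comparing
   [fl] with [fr] gives [f i =1 f j]. *)
have fl i j t : rho i j -> psi (t *: E i j) i j = h i j * f i t.
  move=> rij; have -> : t *: E i j = (t *: E i i) *m E i j.
    by rewrite -scalemxAl mul_delta_mx.
  rewrite psiM ?tA ?EA // (psi_scale t i i) // psi_delta // -/(f i t).
  by rewrite -scalemxAl -scalemxAr mul_delta_mx scalerA tE mulrC.
have fr i j t : rho i j -> psi (t *: E i j) i j = h i j * f j t.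
  move=> rij; have -> : t *: E i j = E i j *m (t *: E j j).
    by rewrite -scalemxAr mul_delta_mx.
  rewrite psiM ?tA ?EA // (psi_scale t j j) // psi_delta // -/(f j t).
  by rewrite -scalemxAl -scalemxAr mul_delta_mx scalerA tE.
have h0 i j : rho i j -> h i j != 0.
  move=> rij; apply: contraTneq isT => e.
  have /(inj _ _ (EA i j rij) (mem0v _))/matrixP/(_ i j) : psi (E i j) = psi 0.
    by rewrite psi_delta // e scale0r psi0.
  by rewrite !mxE !eqxx => /eqP; rewrite oner_eq0.
have frho i j : rho i j -> f i =1 f j.
  by move=> rij t; apply: (mulfI (h0 i j rij)); rewrite -fl // fr.
have f1 i : f i 1 = 1 by rewrite /f scale1r psiE mxE !eqxx.
have entry X i j : X \in A -> psi X i j = h i j * f i (X i j).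
  move=> hX; rewrite -[LHS](tE _ i j) -psi_corner //.
  have [rij|nij] := boolP (rho i j); first exact: fl.
  have -> : X i j = 0 by move/smaP: hX => ->.
  by rewrite /f !scale0r psi0 !mxE mulr0.
have f0 i : f i 0 = 0 by rewrite /f scale0r psi0 mxE.
have hii i : h i i = 1 by rewrite /h psiE mxE !eqxx.
(* The (i,j) entry of (E_ii + s E_ij)(t E_ij + E_jj) is s + t. *)
have edgeD i j : rho i j -> i != j -> {morph f i : s t / s + t}.
  move=> rij ij s t; have ji : j != i by rewrite eq_sym.
  pose X := E i i + s *: E i j; pose Y := t *: E i j + E j j.
  have hX : X \in A by rewrite memvD ?tA.
  have hY : Y \in A by rewrite memvD ?tA.
  have XY : X *m Y = t *: E i j + s *: E i j.
    rewrite mulmxDl !mulmxDr -!scalemxAl -!scalemxAr !mul_delta_mx.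
    by rewrite !mul_delta_mx_0 // !scaler0 addr0 add0r.
  have := congr1 (fun Z : 'M_n => Z i j) (psiM X Y hX hY).
  rewrite /= XY -scalerDl fl // mxE.
  rewrite (bigD1 i) //= (bigD1 j) //= big1 ?addr0; last first.
    move=> k /andP[ki kj]; rewrite entry // !mxE (negPf ki) (negPf kj) /=.
    by rewrite !andbF mulr0 addr0 f0 mulr0 mul0r.
  rewrite !entry // !mxE !eqxx (negPf ij) (negPf ji) !hii /=.
  rewrite !mulr0 !mulr1 !addr0 ?add0r !f1 !mulr1 !mul1r.
  rewrite -mulrDr => /(mulfI (h0 i j rij)); rewrite addrC => ->.
  by rewrite addrC.
apply: (standard_form_of_entries rho_qo Tu (h := h) (s := fun=> false)
  (f := f)) => //.
- move=> i j k rij rjk; rewrite -[RHS](tE _ i k) -psi_delta; last first.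
    by case: rho_qo => _ rtr; apply: rtr rjk.
  rewrite -(mul_delta_mx j i k) psiM ?EA // !psi_delta // -scalemxAl -scalemxAr.
  by rewrite mul_delta_mx scalerA tE.
- move=> i; have [j ij /orP[rij|rji]] := neighbours i.
    exact: edgeD rij ij.
  rewrite eq_sym in ij => s t; rewrite -!(frho j i rji).
  exact: edgeD rji ij _ _.
- move=> i s t; have := psiM _ _ (tA s i i (rii i)) (tA t i i (rii i)).
  rewrite (psi_scale s i i) // (psi_scale t i i) // -!scalemxAl -!scalemxAr.
  by rewrite mul_delta_mx !scalerA {1}/f => ->; rewrite tE.
Qed.

Lemma hom_standard_form op phi :
  injective_hom rho op phi -> has_standard_form rho op phi.
Proof.
case: op; [exact: multiplicative_standard_form|exact: jordan_standard_form|].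
exact: normalized_standard_form.
Qed.

End Multiplicative.

(** * A non-additive map when some central class is a singleton *)

Section Singleton.
Variables (F : fieldType) (n : nat) (rho : rel 'I_n).
Hypotheses (F2 : (2 : F) != 0) (F3 : (3 : F) != 0) (rho_qo : quasi_order rho).
Notation A := (sma F rho).
Notation E := (@delta_mx F n n).
Implicit Types (X Y : 'M[F]_n) (i j : 'I_n).

(* The witness is t |-> 1/t (with 1/0 = 0) on the entry (i,i); the Jordan
   product needs the factor 1/4, for 2 f(x) f(y) = f(2xy). *)
Lemma isolated_not_additive op i :
  (forall j, rho i j || rho j i -> j = i) ->
  exists2 phi : 'M[F]_n -> 'M[F]_n, injective_hom rho op phi &
    ~ {in A &, {morph phi : X Y / X + Y}}.
Proof.
move=> iso; pose a : F := if op is Jordan then 4 else 1.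
have F4 : (4 : F) != 0 by rewrite (_ : 4 = 2 * 2) ?mulf_neq0 // -natrM.
have a0 : a != 0 by rewrite /a; case: (op); rewrite ?oner_eq0.
pose f (t : F) := (a * t)^-1.
pose P := E i i; pose Q := 1%:M - P.
have PP : P *m P = P by rewrite mul_delta_mx.
have PQ : P *m Q = 0 by rewrite mulmxBr mulmx1 PP subrr.
have QP : Q *m P = 0 by rewrite mulmxBl mul1mx PP subrr.
have QQ : Q *m Q = Q by rewrite {2}/Q mulmxBr mulmx1 QP subr0.
(* Row and column [i] of [X] vanish off the diagonal, so [P] is central in the algebra. *)
have cent X : X \in A -> X *m P = X i i *: P /\ P *m X = X i i *: P.
  move/smaP => hX; split; apply/matrixP => k l;
    rewrite ?mulmx_deltaE ?delta_mulmxE !mxE.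
    have [->|ki] := eqVneq k i; first by [].
    rewrite mulr0 hX ?mul0r //; apply: contra ki => r.
    by apply/eqP/iso; rewrite r orbT.
  have [->|li] := eqVneq l i; first by rewrite andbT mulrC.
  rewrite andbF mulr0 hX ?mulr0 //; apply: contra li => r.
  by apply/eqP/iso; rewrite r.
have centQ X : X \in A -> X *m Q = Q *m X.
  by move=> /cent[h1 h2]; rewrite mulmxBr mulmxBl mulmx1 mul1mx h1 h2.
have P1 : Q + P = 1%:M by rewrite subrK.
(* The complementary summand [Q] is left unchanged; only the scalar at (i,i) is replaced. *)
clearbody Q; pose phi X := X *m Q + f (X i i) *: P.
have mulE X Y : X \in A -> Y \in A ->
    phi X *m phi Y = X *m Y *m Q + (f (X i i) * f (Y i i)) *: P.
  move=> hX hY; rewrite /phi mulmxDl !mulmxDr -!scalemxAr -!scalemxAl.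
  rewrite -(mulmxA X Q P) QP mulmx0 scaler0 addr0 PP scalerA.
  rewrite (centQ Y hY) [P *m _]mulmxA PQ mul0mx scaler0 add0r.
  rewrite -(mulmxA X Q) (mulmxA Q Q) QQ -(centQ Y hY) !mulmxA.
  by rewrite [f (Y i i) * _]mulrC.
have diagM X Y : X \in A -> Y \in A -> (X *m Y) i i = X i i * Y i i.
  move=> hX hY; have [h _] := cent _ (mulmx_sma rho_qo hX hY).
  have /matrixP/(_ i i) := h.
  rewrite -mulmxA (cent Y hY).1 -scalemxAr (cent X hX).1.
  by rewrite !mxE !eqxx !mulr1 mulrC => ->.
exists phi.
  split=> [X Y hX hY e|X Y hX hY].
    have eP : f (X i i) *: P = f (Y i i) *: P.
      have := congr1 (mulmx^~ P) e.
      rewrite /= /phi !mulmxDl -!mulmxA QP !mulmx0 !add0r.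
      by rewrite -!scalemxAl PP.
    have eQ : X *m Q = Y *m Q by apply: (addIr (f (X i i) *: P)); rewrite {2}eP.
    have exy : X i i = Y i i.
      have /matrixP/(_ i i) := eP; rewrite !mxE !eqxx !mulr1 => /invr_inj.
      exact: mulfI.
    rewrite -[X]mulmx1 -[Y]mulmx1 -P1 !mulmxDr eQ.
    by rewrite (cent X hX).1 (cent Y hY).1 exy.
  have fE : f ((bullet op X Y) i i) =
      if op is Jordan then 2 * (f (X i i) * f (Y i i))
      else f (X i i) * f (Y i i).
    rewrite /f /a; case: op {a a0 f phi mulE} => /=.
    - by rewrite diagM // !mul1r invfM.
    - rewrite mxE !diagM // (mulrC (Y i i)) -!invfM.
      (* Zero entries are treated apart through 1/0 = 0, since [field] needs non-zero
         denominators. *)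
      have [->|x0] := eqVneq (X i i) 0.
        by rewrite !mul0r !mulr0 !mul0r invr0 mulr0 addr0 mulr0 invr0.
      have [->|y0] := eqVneq (Y i i) 0.
        by rewrite !mulr0 !invr0 mulr0 addr0 mulr0 invr0.
      by field; rewrite x0 y0 F4 -mulr2n -mulr_natr !mulf_neq0.
    - rewrite mxE [(X *m Y + Y *m X) i i]mxE !diagM // !mul1r.
      rewrite (mulrC (Y i i)) -invfM; congr (_^-1).
      by field.
  have -> : phi (bullet op X Y) =
      bullet op X Y *m Q + f ((bullet op X Y) i i) *: P by [].
  rewrite {}fE; clearbody f; case: op {a a0} => /=; rewrite !mulE //.
  - rewrite addrACA -mulmxDl; congr (_ + _).
    by rewrite (mulrC (f (Y i i))) -mulr2n -scaler_nat scalerA.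
  - rewrite addrACA -!scalemxAl -mulmxDl scalerDr; congr (_ + _).
    rewrite (mulrC (f (Y i i))) -scalerDl scalerA; congr (_ *: _); by field.
have PA : P \in A by exact: delta_mx_diag_sma.
(* Additivity at [P + P] would give 1/(2a) = 2/a, hence 1 = 4 and 3 = 0. *)
move=> /(_ P P PA PA) e; have := congr1 (fun Z => (Z *m P) i i) e.
rewrite /phi !mulmxDl -!(mulmxA _ Q) !QP !mulmx0 !add0r -!scalemxAl PP.
rewrite !mxE !eqxx !mulr1 /f => {}e.
have a2 : a * (1 + 1) != 0 by rewrite mulf_neq0.
have h : 1 = 4 :> F.
  by rewrite -[LHS](mulfV a2) e /=; field; rewrite a0.
move/negP: F3; apply; apply/eqP; transitivity (4 - 1 : F); first by ring.
by apply/eqP; rewrite subr_eq0 -h.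
Qed.

End Singleton.

(** * The equivalence of the three conditions over the complex numbers *)

Import Num.Theory.

Theorem theorem3p1 (R : realType) (n : nat) (rho : rel 'I_n)
    (hrho : quasi_order rho) (op : product) :
  let cond_i :=
    forall c : {set 'I_n}, c \in central_classes rho -> (2 <= #|c|)%N in
  let cond_ii :=
    forall phi : 'M[R[i]]_n -> 'M[R[i]]_n, injective_hom rho op phi ->
      {in sma R[i] rho &, {morph phi : X Y / X + Y}} in
  let cond_iii :=
    forall phi : 'M[R[i]]_n -> 'M[R[i]]_n, injective_hom rho op phi ->
      exists (T : 'M[R[i]]_n) (g : 'I_n -> 'I_n -> R[i])
             (omega : {set 'I_n} -> {rmorphism R[i] -> R[i]})
             (dag : {set 'I_n} -> bool),
        [/\ T \in unitmx,
            transitive_map rho g,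
            op = Standard ->
              forall c : {set 'I_n}, c \in central_classes rho -> dag c = false &
            {in sma R[i] rho, forall X : 'M[R[i]]_n,
              phi X = standard_form rho T g omega dag X}] in
  (cond_i <-> cond_ii) /\ (cond_i <-> cond_iii).
Proof.
move=> cond_i cond_ii cond_iii.
have F2 : (2 : R[i]) != 0 by rewrite pnatr_eq0.
have F3 : (3 : R[i]) != 0 by rewrite pnatr_eq0.
have i_iii : cond_i -> cond_iii.
  move=> hi phi; apply: hom_standard_form => // i.
  apply: central_class_neighbour; apply: hi.
  by apply/central_classesP; exists i.
have iii_ii : cond_iii -> cond_ii.
  move=> h phi /h[T [g [omega [dag [_ _ _ e]]]]] X Y hX hY.
  by rewrite !e ?memvD // standard_form_add.
have ii_i : cond_ii -> cond_i.
  move=> h c /central_classesP[i ->]; rewrite ltnNge.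
  (* In a class with at most one element every neighbour of [i] equals [i], so [i] is isolated. *)
  apply/negP => /card_le1_eqP c1.
  have [|phi hphi] := isolated_not_additive F2 F3 hrho op (i := i).
    move=> j r; apply: c1; first exact: central_class_id.
    by rewrite inE; apply: connect1.
  by case; apply: h.
by split; split; auto.
Qed.
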